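(* Let $\alpha$ be a non-zero algebraic number. If $\bar\gamma\in S(K_\alpha)$ satisfies $\bar M(\bar\gamma)\le M(\alpha)$, then there exists a non-zero rational number $r$ such that $\bar M(\bar\gamma^r)=\inf\{\bar M(\bar\gamma^s):s\in\mathbb Q^\times\}$ and $\bar\gamma^r\in\bar{\mathcal B}(\alpha)$.
   Context: For a non-zero algebraic number $\gamma$ with minimal polynomial $A\prod_{n=1}^N(x-\gamma_n)$ over $\mathbb Z$ (primitive, $A>0$), $M(\gamma)=A\prod_{n=1}^N\max\{1,|\gamma_n|\}$. $V=\overline{\mathbb Q}^\times/\mathrm{Tor}(\overline{\mathbb Q}^\times)$ is a $\mathbb Q$-vector space written multiplicatively, with scalar multiplication $\bar\beta\mapsto\bar\beta^s$ ($s\in\mathbb Q$) induced by taking any $s$-th power; $\pi$ is the quotient map. For $\bar\beta\in V$, $\bar M(\bar\beta)=\inf\{M(\beta):\beta\in\pi^{-1}(\bar\beta)\}$. $K_\alpha$ is the Galois closure of $\mathbb Q(\alpha)$ over $\mathbb Q$; $\mathrm{rad}(K)=\{\gamma\in\overline{\mathbb Q}^\times:\gamma^n\in K\text{ for some }n\in\mathbb N\}$ and $S(K)=\pi(\mathrm{rad}(K))$. $\mathcal B(\alpha)=\{\gamma\in K_\alpha^\times:M(\gamma)\le M(\alpha)\}$ and $\bar{\mathcal B}(\alpha)=\pi(\mathcal B(\alpha))$. *)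

(* Defs.v *)
From HB Require Import structures.
From mathcomp Require Import all_boot all_order all_algebra all_field.
From Stdlib Require Import ClassicalEpsilon.
Set Implicit Arguments. Unset Strict Implicit. Unset Printing Implicit Defensive.
Import Order.TTheory GRing.Theory Num.Theory.
Local Open Scope ring_scope.

(* p is the minimal polynomial of g over Z: a non-zero integer polynomial of
   least degree having g as a root, primitive with positive leading coefficient
   (zcontents p = sgz(lead_coef p) * gcd of coefficients, so zcontents p = 1
   means exactly: primitive and lead_coef p > 0). *)
Definition is_minpolyZ (g : algC) (p : {poly int}) : Prop :=
  [/\ p != 0, root (map_poly intr p) g,
      (forall q : {poly int}, q != 0 -> root (map_poly intr q) g ->
          (size p <= size q)%N)
    & zcontents p = 1].

Definition minpolyZ (g : algC) : {poly int} :=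
  epsilon (inhabits 0) (is_minpolyZ g).

Definition rootsC (q : {poly algC}) : seq algC := sval (closed_field_poly_normal q).

Definition mahler (g : algC) : algC :=
  let p := minpolyZ g in
  (lead_coef p)%:~R * \prod_(z <- rootsC (map_poly intr p)) Num.max 1 `|z|.

(* ---------- V = Qbar^x / Tor, represented by non-zero representatives ---------- *)

(* d is a representative of the class  (pi g)^s  (s rational): writing
   s = numq s / denq s, d^(denq s) and g^(numq s) agree modulo torsion. *)
Definition fiber_pow (g : algC) (s : rat) (d : algC) : Prop :=
  d != 0 /\ exists n : nat, (0 < n)%N /\
    d ^ (denq s * n%:Z) = g ^ (numq s * n%:Z).

Definition fiber (g : algC) : algC -> Prop := fiber_pow g 1.

Definition inf_le (A : algC -> Prop) (c : algC) : Prop :=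
  forall e : algC, 0 < e -> exists x, A x /\ x < c + e.

Definition inf_le_inf (A B : algC -> Prop) : Prop :=
  forall y, B y -> inf_le A y.

(* the set {M(d) : d in pi^{-1}((pi g)^s)} whose infimum is  Mbar((pi g)^s) *)
Definition Mset (g : algC) (s : rat) : algC -> Prop :=
  fun x => exists d, fiber_pow g s d /\ x = mahler d.

Inductive field_gen (S : algC -> Prop) : algC -> Prop :=
| fg_gen x : S x -> field_gen S x
| fg_rat (q : rat) : field_gen S (ratr q)
| fg_add x y : field_gen S x -> field_gen S y -> field_gen S (x + y)
| fg_opp x : field_gen S x -> field_gen S (- x)
| fg_mul x y : field_gen S x -> field_gen S y -> field_gen S (x * y)
| fg_inv x : field_gen S x -> field_gen S (x^-1).

(* K_alpha: Galois closure of Q(alpha) = Q(all conjugates of alpha) *)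
Definition Kgal (a : algC) : algC -> Prop :=
  field_gen (fun z => root (minCpoly a) z).

Definition rad (K : algC -> Prop) (g : algC) : Prop :=
  g != 0 /\ exists n : nat, (0 < n)%N /\ K (g ^+ n).

(* pi g \in S(K) = pi(rad K) *)
Definition inS (K : algC -> Prop) (g : algC) : Prop :=
  exists g', fiber g g' /\ rad K g'.

Definition Bset (a : algC) (g : algC) : Prop :=
  Kgal a g /\ g != 0 /\ mahler g <= mahler a.

(* (pi g)^s \in Bbar(alpha) = pi(B(alpha)) *)
Definition inBbar (a g : algC) (s : rat) : Prop :=
  exists d, fiber_pow g s d /\ Bset a d.

(* Main.v *)
Require Import Defs.
From HB Require Import structures.
From mathcomp Require Import all_boot all_order all_algebra all_field zify ring.
From Stdlib Require Import ClassicalEpsilon Classical.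
Set Implicit Arguments. Unset Strict Implicit. Unset Printing Implicit Defensive.
Import Order.TTheory GRing.Theory Num.Theory.
Local Open Scope ring_scope.

(** Write K for the Galois closure of Q(alpha). If d^n lies in K, the conjugates of d over Q
    fall into blocks, namely the orbits over K; within a block all n-th powers agree, so the
    product delta of the block of d lies in K and equals a power d^L up to a root of unity.
    As K is normal, every conjugate of delta is one of the block products. Multiplying the
    minimal polynomial A * prod (X - d_i) out along the blocks keeps its coefficients algebraic
    integers, so the leading coefficient of the minimal polynomial of delta divides A; since
    all members of a block have the same modulus, M(delta) <= M(d). Hence the infima over all
    fibers are controlled by elements of K, which have bounded degree, and by Northcott's
    theorem the least Mahler measure among them is attained. *)

(** * Polynomials with algebraic integer coefficients: removing and merging roots *)

Lemma Aint_integralP (x : algC) :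
  reflect (integralOver (intr : int -> algC) x) (x \in Aint).
Proof.
apply: (iffP idP) => [|[p mon_p px0]].
  rewrite unfold_in => /floorpP[q Dq]; exists q; last first.
    by rewrite -Dq root_minCpoly.
  have := minCpoly_monic x.
  by rewrite Dq !monicE lead_coef_map_inj ?rmorph0 // ?pmulrn;
    [rewrite -[1]/(1%:~R) eqr_int | exact: intr_inj].
apply: root_monic_Aint px0 _ _; first exact: monic_map.
by apply/polyOverP=> i; rewrite coef_map /= rpred_int_num.
Qed.

Lemma Aint_root_monic (p : {poly algC}) (x : algC) :
  p \is monic -> p \is a polyOver Aint -> root p x -> x \in Aint.
Proof.
move=> mon_p /allP pA px0; apply/Aint_integralP.
by apply: integral_root_monic mon_p px0 _ => c /pA/Aint_integralP.
Qed.

(** With c the leading coefficient and n the degree, c^(n-1) p(x) is a monic polynomial [t] in c x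
    whose coefficients are again algebraic integers. *)
Lemma Aint_lead_coef_root (p : {poly algC}) (x : algC) :
  p \is a polyOver Aint -> root p x -> lead_coef p * x \in Aint.
Proof.
have [-> | nz_p] := eqVneq p 0; first by rewrite lead_coef0 mul0r rpred0.
move=> /polyOverP pA px0; set c := lead_coef p; pose n := (size p).-1.
have szp : size p = n.+1 by rewrite prednK // size_poly_gt0.
have n_gt0 : (0 < n)%N by have := root_size_gt1 nz_p px0; rewrite szp.
pose t := \poly_(i < n.+1) (if i == n then 1 else p`_i * c ^+ (n.-1 - i)).
have lt : lead_coef t = 1 by rewrite lead_coef_poly ?eqxx ?oner_eq0.
apply: (@Aint_root_monic t); first by rewrite monicE lt.
  apply/polyOver_poly => i _; case: ifP => _; rewrite ?rpred1 //.
  by rewrite rpredM ?rpredX ?pA.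
rewrite rootE horner_poly big_ord_recr /= eqxx mul1r.
transitivity (c ^+ n.-1 * p.[x] == 0); last by rewrite (rootP px0) mulr0 eqxx.
congr (_ == _); rewrite horner_coef szp big_ord_recr /= mulrDr big_distrr /=.
congr (_ + _).
  apply: eq_bigr => i _; rewrite (ltn_eqF (ltn_ord i)) exprMn.
  have -> : (n.-1 = (n.-1 - i) + i)%N by rewrite subnK // -ltnS prednK.
  by rewrite addnK exprD !mulrA [c ^+ _ * _ * _]mulrAC [c ^+ _ * p`_i]mulrC.
by rewrite -[p`_n]/(lead_coef p) mulrA -exprSr prednK // exprMn.
Qed.

(** Induction on the size of p, stripping its top term c X^k. The product has leading coefficient c
    and root a, so c and c a are algebraic integers, and c X^k (X - a) can be subtracted. The second
    half follows from a p = p X - p (X - a). *)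
Lemma polyOver_Aint_mulXsubC (p : {poly algC}) (a : algC) :
  p * ('X - a%:P) \is a polyOver Aint ->
  p \is a polyOver Aint /\ a *: p \is a polyOver Aint.
Proof.
move=> pA; suff pA1 : p \is a polyOver Aint.
  split=> //; have -> : a *: p = p * 'X - p * ('X - a%:P).
    by rewrite mulrBr subKr mulrC mul_polyC.
  by rewrite rpredB // rpredM ?polyOverX.
have [n] := ubnP (size p); elim: n => // n IHn in p pA *.
rewrite ltnS => szp; have [-> | nz_p] := eqVneq p 0; first exact: rpred0.
set k := (size p).-1; have szk : size p = k.+1 by rewrite prednK ?size_poly_gt0.
pose p1 := p - p`_k *: 'X^k.
have cA : p`_k \in Aint.
  by move/polyOverP/(_ k.+1): (pA); rewrite mulrBr coefB coefMX coefMC /=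
    [p`_k.+1]nth_default ?szk // mul0r subr0.
have caA : a * p`_k \in Aint.
  have := Aint_lead_coef_root pA (_ : root _ a).
  by rewrite rootM root_XsubC eqxx orbT lead_coefM lead_coefXsubC mulr1 mulrC => ->.
have Dp : p = p1 + p`_k *: 'X^k by rewrite subrK.
rewrite Dp rpredD ?polyOverZ ?polyOverXn //.
apply: IHn.
  rewrite mulrBl rpredB // mulrBr rpredB //.
    by rewrite rpredM ?polyOverX ?polyOverZ ?polyOverXn.
  by rewrite [_ * a%:P]mulrC mul_polyC scalerA polyOverZ ?polyOverXn.
apply: leq_trans szp; rewrite szk ltnS; apply/leq_sizeP => j.
rewrite leq_eqVlt coefB coefZ coefXn => /predU1P[<- | lt_k_j].
  by rewrite eqxx mulr1 subrr.
by rewrite gtn_eqF // mulr0 subr0 nth_default // szk.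
Qed.

(** Removing the root b makes b g (X - a) integral, and removing a from that makes a b g integral;
    then g (X - a b) = g X - a b g. *)
Lemma polyOver_Aint_merge2 (g : {poly algC}) (a b : algC) :
  g * ('X - a%:P) * ('X - b%:P) \is a polyOver Aint ->
  g * ('X - (a * b)%:P) \is a polyOver Aint.
Proof.
move=> gabA; have [gaA bgaA] := polyOver_Aint_mulXsubC gabA.
have [gA _] := polyOver_Aint_mulXsubC gaA.
rewrite scalerAl in bgaA; have [_ abgA] := polyOver_Aint_mulXsubC bgaA.
rewrite mulrBr rpredB //; first by rewrite rpredM ?polyOverX.
by rewrite [_ * _%:P]mulrC mul_polyC -scalerA.
Qed.

Lemma polyOver_Aint_merge (g : {poly algC}) (s : seq algC) :
  g * \prod_(x <- s) ('X - x%:P) \is a polyOver Aint ->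
  g * ('X - (\prod_(x <- s) x)%:P) \is a polyOver Aint.
Proof.
elim: s g => [|a s IHs] g; last first.
  by rewrite !big_cons mulrA => /IHs/polyOver_Aint_merge2.
rewrite !big_nil mulr1 => gA.
by rewrite rpredM // rpredB ?polyOverX ?polyOverC.
Qed.

Lemma polyOver_Aint_merge_all (g : {poly algC}) (ss : seq (seq algC)) :
  g * \prod_(s <- ss) \prod_(x <- s) ('X - x%:P) \is a polyOver Aint ->
  g * \prod_(s <- ss) ('X - (\prod_(x <- s) x)%:P) \is a polyOver Aint.
Proof.
elim: ss g => [|s ss IHss] g; rewrite ?big_nil // !big_cons.
rewrite mulrCA mulrC => /polyOver_Aint_merge; rewrite mulrAC => /IHss.
by rewrite mulrA.
Qed.

Lemma polyOver_Aint_drop_roots (g : {poly algC}) (s : seq algC) :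
  g * \prod_(x <- s) ('X - x%:P) \is a polyOver Aint -> g \is a polyOver Aint.
Proof.
elim: s g => [|a s IHs] g; first by rewrite big_nil mulr1.
by rewrite big_cons mulrA => /IHs/polyOver_Aint_mulXsubC[].
Qed.

(** * Roots of polynomials, and annihilating polynomials of least degree *)

Lemma rootsCE (q : {poly algC}) :
  q = lead_coef q *: \prod_(z <- rootsC q) ('X - z%:P).
Proof. exact: svalP (closed_field_poly_normal q). Qed.

Lemma mem_rootsC (q : {poly algC}) (z : algC) :
  q != 0 -> (z \in rootsC q) = root q z.
Proof.
move=> nz_q; rewrite {2}[q]rootsCE rootZ ?lead_coef_eq0 //.
by rewrite root_prod_XsubC.
Qed.

Lemma uniq_rootsC (q : {poly algC}) :
  q != 0 -> separable_poly q -> uniq (rootsC q).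
Proof.
move=> nz_q; rewrite {1}[q]rootsCE -separable_prod_XsubC.
rewrite !unlock derivZ coprimepZl ?lead_coef_eq0 //.
by rewrite coprimepZr ?lead_coef_eq0.
Qed.

Section LeastRoot.

Variables (R : idomainType) (iota : {rmorphism R -> algC}).
Hypothesis iota_inj : injective iota.

Local Notation "p ^i" := (map_poly iota p) (at level 2, format "p ^i").

(** Kept free of normalization and stated over an integral domain, to serve both Z (primitive
    polynomials) and the number field K (monic ones). *)
Definition least_root (p : {poly R}) (x : algC) :=
  [/\ p != 0, root p^i x
    & forall q : {poly R}, q != 0 -> root q^i x -> (size p <= size q)%N].

Lemma map_iota_eq0 p : (p^i == 0) = (p == 0).
Proof.
apply/eqP/eqP => [pi0 | ->]; last exact: rmorph0.
apply/polyP=> i; apply: iota_inj.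
by rewrite -coef_map pi0 !coef0 raddf0.
Qed.

Lemma least_root_exists (x : algC) (q : {poly R}) :
  q != 0 -> root q^i x -> exists p, least_root p x.
Proof.
have [n] := ubnP (size q); elim: n => // n IHn in q *; rewrite ltnS => szq nzq qx.
have [[p [nz_p px lt_p]] | no_p] :=
    classic (exists p, [/\ p != 0, root p^i x & (size p < size q)%N]).
  exact: IHn (leq_trans lt_p szq) nz_p px.
exists q; split=> // p nz_p px; rewrite leqNgt; apply/negP=> lt_p.
by case: no_p; exists p.
Qed.

(** The remainder of the pseudo-division of q by p vanishes at x and is shorter than p. Over a
    domain [%|] allows a non-zero constant factor, so it is divisibility over the fraction field. *)
Lemma root_least_root (p q : {poly R}) (x : algC) :
  least_root p x -> root q^i x = (p %| q).
Proof.
case=> nz_p px min_p; apply/idP/idP => [qx | /Pdiv.Idomain.dvdpP[[c h] /= nz_c Dq]].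
  apply/modp_eq0P/eqP; apply: contraTT qx => nz_r; apply/negP => qx.
  have: (size p <= size (q %% p)%R)%N; last by rewrite leqNgt ltn_modp nz_p.
  apply: min_p nz_r _; rewrite -[q %% p](addKr (q %/ p * p)) -Pdiv.Idomain.divp_eq addrC.
  rewrite rmorphB rmorphM /= map_polyZ /= rootE !hornerE (rootP px) (rootP qx).
  by rewrite !mulr0 subrr.
have := congr1 (fun u => root u^i x) Dq.
rewrite map_polyZ rootZ ?raddf_eq0 // => ->.
by rewrite rmorphM rootM px orbT.
Qed.

(** Irreducibility in disguise. If u is least for y, then p = h u up to a constant; h is too short
    to vanish at x, so u does, and u is no shorter than p. *)
Lemma least_root_conj (p : {poly R}) (x y : algC) :
  least_root p x -> root p^i y -> least_root p y.
Proof.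
move=> min_px py; have [nz_p px min_p] := min_px; split=> // q nz_q qy.
have [u min_u] := least_root_exists nz_p py.
have [nz_u uy /(_ q nz_q qy) le_uq] := min_u.
apply: leq_trans le_uq.
have:= root_least_root p min_u; rewrite py => /esym/Pdiv.Idomain.dvdpP[[c h] /= nz_c Dp].
have nz_h: h != 0.
  by apply: contraNneq nz_p => h0; move/eqP: Dp; rewrite h0 mul0r scale_poly_eq0 (negPf nz_c).
have: root (h * u)^i x by rewrite -Dp map_polyZ rootE hornerZ (rootP px) mulr0.
rewrite rmorphM rootM => /orP[hx | ux]; last exact: min_p.
have sz_u: (1 < size u)%N.
  by rewrite -(size_map_inj_poly iota_inj) ?rmorph0 // (root_size_gt1 _ uy) ?map_iota_eq0.
have := min_p _ nz_h hx; rewrite -(size_scale p nz_c) Dp size_mul //.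
by case: (size u) sz_u => [|[|k]] // _; rewrite addnS /= addnS ltnNge leq_addr.
Qed.

(** A multiple root would also be a root of the derivative, which is shorter than p and non-zero in
    characteristic 0, while p is least for each of its roots. *)
Lemma least_root_separable (p : {poly R}) (x : algC) :
  least_root p x -> uniq (rootsC p^i).
Proof.
move=> min_p; have [nz_p px _] := min_p.
have sz_p: (1 < size p)%N.
  by rewrite -(size_map_inj_poly iota_inj) ?rmorph0 // (root_size_gt1 _ px) ?map_iota_eq0.
apply: uniq_rootsC; first by rewrite map_iota_eq0.
rewrite unlock; apply/Pdiv.ClosedField.coprimepP=> z pz; apply/negP=> p'z.
have [_ _ min_pz] := least_root_conj min_p pz.
have: (size p <= size p^`())%N.
  apply: min_pz; last by rewrite rootE -deriv_map.
  case Dn: (size p) sz_p => [|[|n]] // _.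
  apply/eqP=> /polyP/(_ n)/(congr1 iota); rewrite coef0 coef_deriv raddf0 raddfMn.
  have -> : p`_n.+1 = lead_coef p by rewrite lead_coefE Dn.
  by move/eqP; rewrite mulrn_eq0 /= raddf_eq0 // lead_coef_eq0 (negPf nz_p).
by rewrite leqNgt lt_size_deriv.
Qed.

Lemma monic_least_root_unique (p q : {poly R}) (x : algC) :
  p \is monic -> q \is monic -> least_root p x -> least_root q x -> p = q.
Proof.
move=> mon_p mon_q min_p min_q; have [_ px _] := min_p; have [_ qx _] := min_q.
apply/eqP; rewrite -eqp_monic // /eqp.
by rewrite -(root_least_root q min_p) qx -(root_least_root p min_q) px.
Qed.

End LeastRoot.

(** * Conjugation by automorphisms, and the Galois closure K as a number field *)

Lemma map_ratr_intr (q : {poly int}) :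
  map_poly (ratr : rat -> algC) (map_poly intr q) = map_poly intr q.
Proof.
by rewrite -map_poly_comp; apply: eq_map_poly => c; rewrite /= ratr_int.
Qed.

Lemma map_num_field_ratr (Qs : fieldExtType rat) (iota : {rmorphism Qs -> algC})
    (p : {poly rat}) :
  map_poly iota (map_poly (in_alg Qs) p) = map_poly ratr p.
Proof.
rewrite -map_poly_comp; apply: eq_map_poly => c.
by rewrite /= alg_num_field fmorph_rat.
Qed.

Lemma polyOver1_rat (Qs : fieldExtType rat) (p : {poly Qs}) :
  p \is a polyOver 1%VS -> exists q : {poly rat}, p = map_poly (in_alg Qs) q.
Proof.
move/polyOverP=> pQ; pose a_ i := sig_eqW (vlineP _ _ (pQ i)).
exists (\poly_(i < size p) sval (a_ i)); apply/polyP=> i.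
rewrite coef_map coef_poly /=; case: ltnP => [_ | le_p_i].
  by case: (a_ i).
by rewrite nth_default // scale0r.
Qed.

(** The field generated by the conjugates of x is a splitting field, hence normal over Q; it has an
    automorphism taking x to y, which extends to [algC]. *)
Lemma minCpoly_conj_aut (x y : algC) :
  root (minCpoly x) y -> exists nu : {rmorphism algC -> algC}, nu x = y.
Proof.
move=> pxy; have [p [Dp mon_p] min_p] := minCpolyP x.
have [r Dr] := closed_field_poly_normal (minCpoly x).
rewrite (monicP (minCpoly_monic x)) scale1r in Dr.
have [Qs [iota [s Ds genQs]]] := num_field_exists r.
have iota_inj := fmorph_inj iota.
have Dps : map_poly (in_alg Qs) p = \prod_(z <- s) ('X - z%:P).
  apply: (map_poly_inj iota); rewrite map_num_field_ratr -Dp Dr -Ds.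
  rewrite rmorph_prod big_map; apply: eq_bigr => z _.
  by rewrite rmorphB /= map_polyX map_polyC.
have Qs_split : FieldExt_isSplittingField _ Qs.
  constructor; exists (map_poly (in_alg Qs) p).
    by apply/polyOverP=> i; rewrite coef_map /= rpredZ ?mem1v.
  by exists s; rewrite ?Dps ?eqpxx.
pose L : splittingFieldType rat := HB.pack Qs Qs_split.
have mem_s z : root (minCpoly x) z -> exists2 u : Qs, u \in s & iota u = z.
  by rewrite Dr root_prod_XsubC -Ds => /mapP[u s_u ->]; exists u.
have [x1 s_x1 Dx1] := mem_s x (root_minCpoly x); have [y1 s_y1 Dy1] := mem_s y pxy.
(* The minimal polynomial of [x1] vanishes at x, so it is a multiple of [p] and also has the root
   y. *)
have min_xy : root (minPoly (1%VS : {vspace L}) x1) y1.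
  have [q Dq] := polyOver1_rat (minPolyOver (1%VS : {vspace L}) x1).
  have : root (map_poly iota (minPoly (1%VS : {vspace L}) x1)) x.
    by rewrite -Dx1 fmorph_root root_minPoly.
  rewrite Dq map_num_field_ratr min_p -(fmorph_root iota) Dy1 map_num_field_ratr.
  rewrite -(dvdp_map (ratr : {rmorphism rat -> algC})) -Dp => /root_dvdp.
  exact.
have [g _ Dg] := normalField_root_minPoly (sub1v _) (normalFieldf 1%AS)
   (memvf (x1 : L)) min_xy.
have [nu Dnu] := extend_algC_subfield_aut iota (g : {rmorphism Qs -> Qs}).
by exists nu; rewrite -Dx1 -Dnu -Dy1; congr (iota _); apply: Dg.
Qed.

Lemma field_gen_aut_stable (S : algC -> Prop) (nu : {rmorphism algC -> algC}) x :
  (forall z, S z -> S (nu z)) -> field_gen S x -> field_gen S (nu x).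
Proof.
move=> nuS; elim=> {x} [x Sx | q | x y _ Kx _ Ky | x _ Kx | x y _ Kx _ Ky | x _ Kx].
- exact/fg_gen/nuS.
- by rewrite fmorph_rat; apply: fg_rat.
- by rewrite rmorphD; apply: fg_add.
- by rewrite rmorphN; apply: fg_opp.
- by rewrite rmorphM; apply: fg_mul.
by rewrite fmorphV; apply: fg_inv.
Qed.

Lemma root_minCpoly_aut (nu : {rmorphism algC -> algC}) x z :
  root (minCpoly x) z -> root (minCpoly x) (nu z).
Proof.
have [p [-> _] _] := minCpolyP x; rewrite -(fmorph_root nu) -map_poly_comp.
by rewrite (eq_map_poly (fmorph_rat nu)).
Qed.

Lemma Kgal_aut (a : algC) (nu : {rmorphism algC -> algC}) x :
  Kgal a x -> Kgal a (nu x).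
Proof. by apply: field_gen_aut_stable => z; apply: root_minCpoly_aut. Qed.

Lemma field_gen_exp (S : algC -> Prop) x n :
  field_gen S x -> field_gen S (x ^+ n).
Proof.
move=> Kx; elim: n => [|n IHn]; last by rewrite exprS; apply: fg_mul.
by rewrite expr0 -(rmorph1 (ratr : {rmorphism rat -> algC})); apply: fg_rat.
Qed.

Lemma field_gen_sum (S : algC -> Prop) (I : Type) (r : seq I) (F : I -> algC) :
  (forall i, field_gen S (F i)) -> field_gen S (\sum_(i <- r) F i).
Proof.
move=> KF; apply: big_ind => //; last exact: fg_add.
by rewrite -(rmorph0 (ratr : {rmorphism rat -> algC})); apply: fg_rat.
Qed.

Lemma num_field_field_gen (S : algC -> Prop) (Qs : fieldExtType rat)
    (iota : {rmorphism Qs -> algC}) (s : seq Qs) (y : Qs) :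
  (forall z, z \in s -> S (iota z)) -> y \in <<1 & s>>%VS ->
  field_gen S (iota y).
Proof.
elim/last_ind: s y => [|s z IHs] y Ss.
  rewrite Fadjoin_nil => /vlineP[c ->].
  by rewrite alg_num_field fmorph_rat; apply: fg_rat.
rewrite adjoin_rcons => /Fadjoin_polyP[p /polyOverP pK ->].
rewrite horner_coef rmorph_sum /=; apply: field_gen_sum => i.
rewrite rmorphM rmorphXn /=; apply: fg_mul.
  by apply: IHs (pK i) => u s_u; apply: Ss; rewrite mem_rcons inE s_u orbT.
by apply/field_gen_exp/fg_gen/Ss; rewrite mem_rcons mem_head.
Qed.

(** Gives K a finite dimension, which bounds degrees, and a type of coefficients for polynomials
    over K. *)
Lemma Kgal_num_field (a : algC) :
  exists (Qs : fieldExtType rat) (iota : {rmorphism Qs -> algC}),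
    forall x, Kgal a x <-> exists y, x = iota y.
Proof.
have [Qs [iota [s Ds genQs]]] := num_field_exists (rootsC (minCpoly a)).
have mem_s z : root (minCpoly a) z = (z \in map iota s).
  by rewrite Ds mem_rootsC ?minCpoly_eq0.
exists Qs, iota => x; split=> [| [y ->]]; last first.
  apply: (@num_field_field_gen _ Qs iota s); last by rewrite genQs memvf.
  by move=> z s_z; rewrite mem_s map_f.
elim=> {x} [x | q | x y _ [u ->] _ [v ->] | x _ [u ->]
           | x y _ [u ->] _ [v ->] | x _ [u ->]].
- by rewrite mem_s => /mapP[u _ ->]; exists u.
- by exists (ratr q); rewrite fmorph_rat.
- by exists (u + v); rewrite rmorphD.
- by exists (- u); rewrite rmorphN.
- by exists (u * v); rewrite rmorphM.
by exists u^-1; rewrite fmorphV.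
Qed.

(** * Integer minimal polynomials, Mahler measure and Northcott's theorem *)

Local Notation intC := (intr : {rmorphism int -> algC}).

Lemma intC_inj : injective intC.
Proof. exact: intr_inj. Qed.

Lemma rat_poly_clear_denominators (p : {poly rat}) :
  p != 0 -> exists q : {poly int}, [/\ q != 0, size q = size p
    & forall x : algC, root (map_poly intr q) x = root (map_poly ratr p) x].
Proof.
have [q [a nz_a Dp]] := rat_poly_scale p => nz_p.
have nz_aV : a%:~R^-1 != 0 :> rat by rewrite invr_eq0 intr_eq0.
have sz_q : size q = size p.
  by rewrite Dp size_scale // size_map_inj_poly //; exact: intr_inj.
exists q; split=> // [|x]; first by rewrite -size_poly_eq0 sz_q size_poly_eq0.
by rewrite Dp map_polyZ rootZ ?fmorph_eq0 // map_ratr_intr.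
Qed.

(** The witness for [epsilon] is the primitive part of a least integer annihilator; [zcontents]
    carries the sign, so dividing by it also makes the leading coefficient positive. *)
Lemma minpolyZP (x : algC) : is_minpolyZ x (minpolyZ x).
Proof.
have [p [Dp mon_p] _] := minCpolyP x.
have [q [nz_q _ Dq]] := rat_poly_clear_denominators (monic_neq0 mon_p).
have qx : root (map_poly intr q) x by rewrite Dq -Dp root_minCpoly.
have [u [nz_u ux min_u]] := least_root_exists (iota := intC) nz_q qx.
apply: (epsilon_spec (inhabits 0) (is_minpolyZ x)); exists (zprimitive u); split.
- by rewrite zprimitive_eq0.
- move: ux; rewrite {1}[u]zpolyEprim map_polyZ rootZ //.
  by rewrite /= intr_eq0 zcontents_eq0.
- by move=> v nz_v vx; rewrite size_zprimitive min_u.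
by rewrite zcontents_primitive nz_u.
Qed.

Lemma least_root_minpolyZ (x : algC) : least_root intC (minpolyZ x) x.
Proof. by have [? ? ?] := minpolyZP x. Qed.

Lemma lead_coef_minpolyZ_gt0 (x : algC) : 0 < lead_coef (minpolyZ x).
Proof.
have [_ _ _ c1] := minpolyZP x.
by rewrite -sgz_gt0 -sgz_contents c1.
Qed.

Lemma lead_coef_map_intC (p : {poly int}) :
  lead_coef (map_poly intC p) = (lead_coef p)%:~R.
Proof. by rewrite lead_coef_map_inj //; exact: intC_inj. Qed.

Lemma ler1_max (z : algC) : 1 <= Num.max 1 `|z|.
Proof. by rewrite comparable_le_max ?lexx // real_comparable ?real1 ?normr_real. Qed.

Lemma ler_norm_max (z : algC) : `|z| <= Num.max 1 `|z|.
Proof.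
by rewrite comparable_le_max ?lexx ?orbT // real_comparable ?real1 ?normr_real.
Qed.

Lemma ler1_prod_max (s : seq algC) : 1 <= \prod_(z <- s) Num.max 1 `|z|.
Proof.
elim: s => [|z s IHs]; rewrite ?big_nil ?big_cons //.
by rewrite mulr_ege1 ?ler1_max.
Qed.

(** With k entries of common modulus c, both sides are 1 if c <= 1 and c^k otherwise. This is what
    makes merging a block harmless for the Mahler measure. *)
Lemma prod_max_norm (s : seq algC) (c : algC) :
  (forall z, z \in s -> `|z| = c) ->
  \prod_(z <- s) Num.max 1 `|z| = Num.max 1 `|\prod_(z <- s) z|.
Proof.
move=> sc; have [-> | ] := eqVneq s [::]; first by rewrite !big_nil normr1 maxxx.
case: s sc => // z s sc _; have c_ge0 : 0 <= c by rewrite -(sc z) ?mem_head.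
have Dc (F : algC -> algC) : \prod_(x <- z :: s) F `|x| = F c ^+ (size s).+1.
  rewrite big_seq (eq_bigr (fun=> F c)) => [|x /sc-> //].
  by rewrite -big_seq big_const_seq count_predT iter_mulr_1.
rewrite normr_prod (Dc (Num.max 1)) (Dc id).
have /orP[c1 | c1] := real_leVge (ger0_real c_ge0) (real1 _).
  by rewrite max_l // expr1n max_l // exprn_ile1.
by rewrite !max_r // exprn_ege1.
Qed.

Lemma mahler_ge0 (x : algC) : 0 <= mahler x.
Proof.
apply: mulr_ge0; first by rewrite ler0z ltW ?lead_coef_minpolyZ_gt0.
by rewrite (le_trans ler01) ?ler1_prod_max.
Qed.

(** A factor X - z turns coefficients into p_(i-1) - z p_i, so it multiplies the bound by at most 2
    max(1, |z|). *)
Lemma norm_coef_prod_XsubC (s : seq algC) i :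
  `|(\prod_(z <- s) ('X - z%:P))`_i| <= 2 ^+ size s * \prod_(z <- s) Num.max 1 `|z|.
Proof.
elim: s i => [|z s IHs] i.
  by rewrite !big_nil mul1r coef1; case: eqP; rewrite ?normr0 ?normr1.
rewrite !big_cons; set p := \prod_(_ <- s) ('X - _).
rewrite mulrBl coefB coefXM coefCM; apply: le_trans (ler_normB _ _) _.
set B := \prod_(_ <- s) Num.max _ _ in IHs *; have B0 : 0 <= 2 ^+ size s * B.
  by apply: le_trans (IHs 0%N); rewrite normr_ge0.
have -> : 2 ^+ size (z :: s) * (Num.max 1 `|z| * B) =
    Num.max 1 `|z| * (2 ^+ size s * B) + Num.max 1 `|z| * (2 ^+ size s * B).
  by rewrite -mulr2n -[RHS]mulr_natl exprS -!mulrA [Num.max _ _ * (_ * B)]mulrCA.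
apply: lerD.
  apply: (@le_trans _ _ (2 ^+ size s * B)).
    by case: eqP => _; rewrite ?normr0 //; apply: IHs.
  by rewrite ler_peMl ?ler1_max.
by rewrite normrM ler_pM ?normr_ge0 ?ler_norm_max ?IHs.
Qed.

Lemma norm_coef_minpolyZ (x : algC) i :
  `|((minpolyZ x)`_i)%:~R| <= 2 ^+ size (minpolyZ x) * mahler x.
Proof.
rewrite /mahler; set p := minpolyZ x; have [nz_p _ _ _] := minpolyZP x.
have Dp := rootsCE (map_poly intC p).
set s := rootsC _ in Dp *; rewrite lead_coef_map_intC in Dp.
have -> : (p`_i)%:~R = (lead_coef p)%:~R * (\prod_(z <- s) ('X - z%:P))`_i.
  by rewrite -coefZ -Dp coef_map.
have lp0 : 0 <= (lead_coef p)%:~R :> algC by rewrite ler0z ltW ?lead_coef_minpolyZ_gt0.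
rewrite normrM (ger0_norm lp0) mulrCA ler_wpM2l //.
apply: le_trans (norm_coef_prod_XsubC s i) _.
rewrite ler_wpM2r //; first by rewrite (le_trans ler01) ?ler1_prod_max.
rewrite ler_weXn2l ?ler1n //.
apply: ltnW; rewrite -(size_prod_XsubC s id).
have -> : size p = size (map_poly intC p) by rewrite size_map_inj_poly //; exact: intC_inj.
by rewrite Dp size_scale // intr_eq0 lead_coef_eq0.
Qed.

(** The Mahler measure depends only on the integer minimal polynomial, and bounded degree and
    measure leave finitely many of these. *)
Lemma mahler_northcott (D : nat) (C : algC) :
  exists vals : seq algC, forall x,
    (size (minpolyZ x) <= D)%N -> mahler x <= C -> mahler x \in vals.
Proof.
pose N := Num.truncn (2 ^+ D * C).
(* Coefficients lie between -N and N; adding N encodes them as ordinals from 0 to 2N. *)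
pose poly_of (f : {ffun 'I_D -> 'I_(N.*2.+1)}) : {poly int} :=
  \poly_(i < D) (if insub i is Some j then (f j : int) - N%:Z else 0).
pose M (p : {poly int}) :=
  (lead_coef p)%:~R * \prod_(z <- rootsC (map_poly intC p)) Num.max 1 `|z|.
exists [seq M (poly_of f) | f : {ffun 'I_D -> 'I_(N.*2.+1)}] => x szp Mx.
set p := minpolyZ x in szp.
have bnd i : (absz (p`_i)%R <= N)%N.
  have C0 : 0 <= 2 ^+ D * C.
    by rewrite mulr_ge0 ?exprn_ge0 // (le_trans (mahler_ge0 x)).
  rewrite truncn_ge_nat // natr_absz intr_norm.
  apply: le_trans (norm_coef_minpolyZ x i) _.
  by rewrite ler_pM ?exprn_ge0 ?mahler_ge0 // ler_weXn2l ?ler1n.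
pose f : {ffun 'I_D -> 'I_(N.*2.+1)} := [ffun i : 'I_D => inord (absz (p`_i + N%:Z))].
apply/imageP; exists f => //; rewrite -[mahler x]/(M p); congr (M _).
have pN i : absz (p`_i + N%:Z) = p`_i + N%:Z :> int.
  by rewrite gez0_abs //; move: (bnd i); lia.
apply/polyP=> i; rewrite coef_poly; case: ltnP => [lt_iD | le_D_i]; last first.
  by rewrite nth_default // (leq_trans szp).
rewrite insubT /= ffunE inordK ?pN ?addrK //.
rewrite -addnn; have := pN i; move: (bnd i); move: (p`_i) => c; lia.
Qed.

(** * Descent into K through products over blocks of conjugates *)

Lemma prod_fibers (T U : eqType) (m : T -> U) (r : seq T) (R : comNzRingType)
    (F : T -> R) :
  \prod_(x <- r) F x = \prod_(f <- undup (map m r)) \prod_(x <- r | m x == f) F x.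
Proof.
transitivity (\prod_(x <- r) \prod_(f <- undup (map m r) | m x == f) F x);
  last by apply: exchange_big_dep.
rewrite big_seq [RHS]big_seq; apply: eq_bigr => x r_x.
rewrite -big_filter (_ : filter _ _ = [:: m x]) ?big_seq1 //.
have := filter_pred1_uniq (undup_uniq (map m r)) (_ : m x \in _).
rewrite mem_undup map_f // => /(_ isT) <-; apply: eq_filter => f.
exact: eq_sym.
Qed.

Lemma int_poly_of_Aint_rat (p : {poly rat}) :
  map_poly (ratr : rat -> algC) p \is a polyOver Aint ->
  exists q : {poly int}, map_poly (intr : int -> algC) q = map_poly ratr p.
Proof.
move/polyOverP=> pA; have pZ : map_poly (ratr : rat -> algC) p \is a polyOver Num.int.
  apply/polyOverP=> i; apply: Cint_rat_Aint; last exact: pA.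
  by rewrite coef_map Crat_rat.
by have /floorpP[q ->] := pZ; exists q.
Qed.

Lemma root_minpolyZ_minCpoly (x y : algC) :
  root (map_poly intr (minpolyZ x)) y = root (minCpoly x) y.
Proof.
have [p [Dp mon_p] min_p] := minCpolyP x.
have min_x := least_root_minpolyZ x; have [nz_x xx _] := min_x.
apply/idP/idP=> [xy | py]; last first.
  rewrite -map_ratr_intr; apply: root_dvdp py.
  by rewrite Dp dvdp_map -min_p map_ratr_intr.
have [q [nz_q _ Dq]] := rat_poly_clear_denominators (monic_neq0 mon_p).
rewrite Dp -Dq (root_least_root intC_inj _ (least_root_conj intC_inj min_x xy)).
by rewrite -(root_least_root intC_inj _ min_x) Dq -Dp root_minCpoly.
Qed.

Section Descent.

Variables (Qs : fieldExtType rat) (iota : {rmorphism Qs -> algC}).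
Hypothesis iota_stable : forall (nu : {rmorphism algC -> algC}) (y : Qs),
  exists z, nu (iota y) = iota z.

Let iota_inj : injective iota := fmorph_inj iota.

Local Notation "p ^i" := (map_poly iota p) (at level 2, format "p ^i").

(** Being monic makes it unique, so equality of [minpolyK] expresses conjugacy over K, and the
    blocks are the fibers of [minpolyK]. *)
Definition minpolyK (x : algC) : {poly Qs} :=
  epsilon (inhabits 0) (fun p => p \is monic /\ least_root iota p x).

Lemma map_iota_intr (p : {poly int}) : (map_poly intr p)^i = map_poly intr p.
Proof.
by rewrite -map_poly_comp; apply: eq_map_poly => c; rewrite /= rmorph_int.
Qed.

Lemma minpolyKP (x : algC) : minpolyK x \is monic /\ least_root iota (minpolyK x) x.
Proof.
apply: (epsilon_spec (inhabits 0) (fun p => p \is monic /\ least_root iota p x)).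
have [nz_px px _] := least_root_minpolyZ x.
have nz_p : map_poly intr (minpolyZ x) != 0 :> {poly Qs}.
  by rewrite -(map_iota_eq0 iota_inj) map_iota_intr (map_iota_eq0 intC_inj).
have [|u [nz_u ux min_u]] := least_root_exists (iota := iota) (x := x) nz_p.
  by rewrite map_iota_intr.
have nz_l : (lead_coef u)^-1 != 0 by rewrite invr_eq0 lead_coef_eq0.
exists ((lead_coef u)^-1 *: u); split.
  by rewrite monicE lead_coefZ mulVf // lead_coef_eq0.
split=> [||q nz_q qx].
- by rewrite scale_poly_eq0 negb_or nz_l.
- by rewrite map_polyZ rootZ //= fmorph_eq0.
by rewrite size_scale // min_u.
Qed.

Lemma root_minpolyK (x : algC) : root (minpolyK x)^i x.
Proof. by have [_ []] := minpolyKP x. Qed.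

Lemma minpolyK_conj (x y : algC) : root (minpolyK x)^i y -> minpolyK y = minpolyK x.
Proof.
move=> xy; have [mon_x min_x] := minpolyKP x; have [mon_y min_y] := minpolyKP y.
apply: (monic_least_root_unique iota_inj mon_y mon_x min_y).
exact: (least_root_conj iota_inj min_x xy).
Qed.

Lemma root_minpolyK_eq (x y : algC) (q : {poly Qs}) :
  minpolyK x = minpolyK y -> root q^i x = root q^i y.
Proof.
move=> eq_xy; have [_ min_x] := minpolyKP x; have [_ min_y] := minpolyKP y.
by rewrite (root_least_root iota_inj q min_x) (root_least_root iota_inj q min_y) eq_xy.
Qed.

Lemma map_poly_aut_iota (nu : {rmorphism algC -> algC}) (p : {poly Qs}) :
  exists q, map_poly nu p^i = q^i.
Proof.
pose f y := sval (constructive_indefinite_description _ (iota_stable nu y)).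
have fP y : nu (iota y) = iota (f y).
  by rewrite /f; case: constructive_indefinite_description.
exists (\poly_(i < size p) f p`_i); apply/polyP=> i; rewrite !coef_map coef_poly /=.
by case: ltnP => [_ | le_p_i]; [rewrite fP | rewrite nth_default // !raddf0].
Qed.

(** By normality, pulling the minimal polynomial of nu x back along the inverse of nu stays over K;
    the result vanishes at x, hence at y. *)
Lemma minpolyK_aut (nu : {rmorphism algC -> algC}) (x y : algC) :
  minpolyK x = minpolyK y -> minpolyK (nu x) = minpolyK (nu y).
Proof.
move=> eq_xy; apply/esym/minpolyK_conj.
have [q Dq] := map_poly_aut_iota (algC_invaut nu) (minpolyK (nu x)).
rewrite -(fmorph_root (algC_invaut nu)) Dq /= algC_autK -(root_minpolyK_eq q eq_xy).
by rewrite -[x](algC_autK nu) -Dq fmorph_root root_minpolyK.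
Qed.

Lemma eq_minpolyK_aut (nu : {rmorphism algC -> algC}) (x y : algC) :
  (minpolyK (nu x) == minpolyK (nu y)) = (minpolyK x == minpolyK y).
Proof.
apply/eqP/eqP => [/(minpolyK_aut (algC_invaut nu)) | /minpolyK_aut //].
by rewrite /= !algC_autK.
Qed.

Variable d : algC.

Let r := rootsC (map_poly intr (minpolyZ d)).
Let nz_pd : map_poly intr (minpolyZ d) != 0 :> {poly algC}.
Proof. by rewrite (map_iota_eq0 intC_inj); have [] := minpolyZP d. Qed.

Let r_uniq : uniq r.
Proof. exact: (least_root_separable intC_inj (least_root_minpolyZ d)). Qed.

Let mem_r y : (y \in r) = root (minCpoly d) y.
Proof. by rewrite mem_rootsC // root_minpolyZ_minCpoly. Qed.

Let perm_aut (nu : {rmorphism algC -> algC}) : perm_eq (map nu r) r.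
Proof.
have u_nu : uniq (map nu r) by rewrite map_inj_uniq //; exact: fmorph_inj.
have sub_nu : {subset map nu r <= r}.
  by move=> _ /mapP[y r_y ->]; rewrite mem_r root_minCpoly_aut -?mem_r.
apply: uniq_perm => //.
by apply: (uniq_min_size u_nu sub_nu _).2; rewrite size_map.
Qed.

(* For f the minimal polynomial over K of a conjugate x of d, this is the norm from K(x) to K of x. *)
Definition block_prod (f : {poly Qs}) : algC := \prod_(x <- r | minpolyK x == f) x.

(** An automorphism permutes the conjugates of d and carries blocks to blocks. *)
Lemma block_prod_aut (nu : {rmorphism algC -> algC}) (x : algC) :
  nu (block_prod (minpolyK x)) = block_prod (minpolyK (nu x)).
Proof.
rewrite /block_prod rmorph_prod -[RHS](perm_big _ (perm_aut nu)) big_map /=.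
by apply: eq_bigl => y; rewrite eq_minpolyK_aut.
Qed.

(** All roots of [minpolyK x] occur in [r], since the integer minimal polynomial of d, read over K,
    vanishes at x and so at every K-conjugate of x. *)
Lemma block_poly (x : algC) : x \in r ->
  (minpolyK x)^i = \prod_(y <- r | minpolyK y == minpolyK x) ('X - y%:P).
Proof.
move=> r_x; have [mon_x min_x] := minpolyKP x.
have nz_x : (minpolyK x)^i != 0 by rewrite map_poly_eq0 monic_neq0.
rewrite -big_filter [LHS]rootsCE lead_coef_map (monicP mon_x) rmorph1 scale1r.
apply/perm_big/uniq_perm; rewrite ?filter_uniq //.
  exact: (least_root_separable iota_inj min_x).
move=> z; rewrite mem_filter mem_rootsC //.
apply/idP/andP=> [xz | [/eqP <- _]]; last exact: root_minpolyK.
have eq_zx := minpolyK_conj xz; split; first exact/eqP.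
move: r_x; rewrite !mem_rootsC // -!map_iota_intr.
by rewrite (root_minpolyK_eq _ eq_zx).
Qed.

Lemma block_prod_num_field (x : algC) : x \in r ->
  exists z, block_prod (minpolyK x) = iota z.
Proof.
(* Up to sign, the block product is the constant term of [minpolyK x]. *)
move=> /block_poly/(congr1 (fun p : {poly algC} => p.[0])).
rewrite -(rmorph0 iota) horner_map rmorph0 horner_prod.
have -> : \prod_(y <- r | minpolyK y == minpolyK x) ('X - y%:P).[0] =
  (\prod_(y <- r | minpolyK y == minpolyK x) -1) * block_prod (minpolyK x).
  rewrite -big_split /=; apply: eq_bigr => y _. rewrite hornerXsubC sub0r; exact: esym (mulN1r y).
rewrite big_const_seq iter_mulr_1; set k := count _ _ => Dx.
exists ((-1) ^+ k * (minpolyK x).[0]); rewrite rmorphM rmorph_sign Dx.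
by rewrite signrMK.
Qed.

Variables (n : nat) (y0 : Qs).
Hypotheses (n_gt0 : (0 < n)%N) (Dn : d ^+ n = iota y0).

(** Writing x = nu d gives x^n = nu (d^n), which is in K by normality; so X^n - x^n has coefficients
    in K and vanishes at y as well. *)
Lemma block_pow (x y : algC) :
  x \in r -> minpolyK x = minpolyK y -> x ^+ n = y ^+ n.
Proof.
rewrite mem_r => /minCpoly_conj_aut[nu Dx] eq_xy.
have [z Dz] := iota_stable nu y0.
have Dxn : x ^+ n = iota z by rewrite -Dz -Dn rmorphXn /= Dx.
have := root_minpolyK_eq ('X^n - z%:P) eq_xy.
rewrite rmorphB /= map_polyXn map_polyC /= !rootE !hornerE -Dxn subrr eqxx.
by move/esym; rewrite subr_eq0 => /eqP.
Qed.

Lemma descent_to_num_field : exists (delta : algC) (L : nat),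
  [/\ (0 < L)%N, exists z, delta = iota z, delta ^+ n = d ^+ (n * L)
    & mahler delta <= mahler d].
Proof.
have r_d : d \in r by rewrite mem_r root_minCpoly.
pose B f := [seq x <- r | minpolyK x == f].
pose fs := undup (map minpolyK r).
(* [L] is the degree of d over K. *)
pose delta := block_prod (minpolyK d); pose L := size (B (minpolyK d)).
exists delta, L; split.
- by rewrite lt0n size_eq0 -has_filter; apply/hasP; exists d.
- exact: block_prod_num_field.
- rewrite /delta /block_prod -big_filter -/(B _) -prodrXl.
  rewrite big_seq (eq_bigr (fun=> d ^+ n)) => [|x]; last first.
    by rewrite mem_filter => /andP[/eqP eq_x r_x]; apply: block_pow.
  by rewrite -big_seq big_const_seq count_predT iter_mulr_1 exprM.
set A := lead_coef (minpolyZ d); set A' := lead_coef (minpolyZ delta).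
pose zs := rootsC (map_poly intr (minpolyZ delta)).
have nz_P : map_poly intr (minpolyZ delta) != 0 :> {poly algC}.
  by rewrite (map_iota_eq0 intC_inj); have [] := minpolyZP delta.
have zs_uniq : uniq zs.
  exact: (least_root_separable intC_inj (least_root_minpolyZ delta)).
(* The conjugates [zs] of delta are distinct block products; [t] collects the remaining ones, with
   repetitions. *)
have [t perm_t] : exists t, perm_eq (map block_prod fs) (zs ++ t).
  have [|s /perm_to_subseq[t perm_t] perm_s] := (count_subseqP zs (map block_prod fs)).1.
    move=> z; rewrite (count_uniq_mem _ zs_uniq); case: (boolP (z \in zs)) => // zs_z.
    rewrite -has_count has_pred1.
    move: zs_z; rewrite mem_rootsC // root_minpolyZ_minCpoly.
    case/minCpoly_conj_aut=> nu <-; rewrite block_prod_aut map_f //.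
    by rewrite mem_undup map_f // mem_r root_minCpoly_aut ?root_minCpoly.
  by exists t; rewrite (permPl perm_t) perm_cat2r perm_sym.
have A_gt0 : 0 < A := lead_coef_minpolyZ_gt0 d.
have A'_gt0 : 0 < A' := lead_coef_minpolyZ_gt0 delta.
have fsA : (A%:~R : algC)%:P * \prod_(f <- fs) ('X - (block_prod f)%:P)
    \is a polyOver Aint.
  have BE F f : \prod_(x <- B f) F x = \prod_(x <- r | minpolyK x == f) F x :> {poly algC}.
    exact: big_filter.
  have BE' f : \prod_(x <- B f) x = block_prod f by exact: big_filter.
  suff: (A%:~R : algC)%:P * \prod_(s <- map B fs) ('X - (\prod_(x <- s) x)%:P)
      \is a polyOver Aint.
    by rewrite big_map; under eq_bigr do rewrite BE'.
  apply: polyOver_Aint_merge_all; rewrite big_map; under eq_bigr do rewrite BE.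
  rewrite -prod_fibers mul_polyC.
  have := rootsCE (map_poly intr (minpolyZ d)); rewrite lead_coef_map_intC -/r => <-.
  by apply/polyOverP=> i; rewrite coef_map /= Aint_int.
have zsA : (A%:~R : algC)%:P * \prod_(z <- zs) ('X - z%:P) \is a polyOver Aint.
  apply: (@polyOver_Aint_drop_roots _ t); rewrite -mulrA -big_cat /=.
  by rewrite -(perm_big _ perm_t) big_map.
have DP := rootsCE (map_poly intr (minpolyZ delta)).
rewrite lead_coef_map_intC -/zs -/A' in DP.
have nz_A' : A'%:~R != 0 :> algC by rewrite intr_eq0 gt_eqF.
(* Rescaled to leading coefficient A, the minimal polynomial of delta is rational with algebraic
   integer coefficients, hence comes from an integer polynomial [U]. *)
pose Pq : {poly rat} := (A%:~R / A'%:~R) *: map_poly intr (minpolyZ delta).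
have DPq : map_poly ratr Pq = (A%:~R : algC)%:P * \prod_(z <- zs) ('X - z%:P).
  rewrite map_polyZ /= map_ratr_intr DP scalerA mul_polyC rmorphM fmorphV /= !ratr_int.
  by rewrite divfK.
have [|U DU] := @int_poly_of_Aint_rat Pq; first by rewrite DPq.
rewrite DPq in DU.
have lead_U : lead_coef U = A.
  apply: (@intr_inj algC); rewrite -lead_coef_map_intC [LHS]/= DU lead_coefM lead_coefC.
  by rewrite (monicP (monic_prod_XsubC _ _ _)) mulr1.
(* Since [minpolyZ delta] is primitive, Gauss's lemma [dvdpP_int] turns this into an exact
   factorization over Z, so A' divides A. *)
have dv_U : minpolyZ delta %| U.
  rewrite -(root_least_root intC_inj _ (least_root_minpolyZ delta)) /= DU.
  rewrite rootM root_prod_XsubC mem_rootsC //.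
  by have [_ -> _ _] := minpolyZP delta; rewrite orbT.
have [_ _ _ c1] := minpolyZP delta.
have [h] := dvdpP_int dv_U.
have -> : zprimitive (minpolyZ delta) = minpolyZ delta.
  by rewrite [RHS]zpolyEprim c1 scale1r.
move/(congr1 lead_coef); rewrite lead_U lead_coefM -/A' => DA.
have le_A : A' <= A.
  have : 0 < A' * lead_coef h by rewrite -DA.
  by rewrite pmulr_rgt0 // gtz0_ge1 DA => h_ge1; rewrite ler_peMr // ltW.
rewrite /mahler -/A -/A' -/zs -/r.
apply: (@le_trans _ _ (A%:~R * \prod_(z <- zs) Num.max 1 `|z|)).
  by rewrite ler_wpM2r ?ler_int // (le_trans ler01) ?ler1_prod_max.
rewrite ler_wpM2l //; first by rewrite ler0z ltW.
have -> : \prod_(z <- r) Num.max 1 `|z| = \prod_(z <- map block_prod fs) Num.max 1 `|z|.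
  rewrite (prod_fibers minpolyK) big_map big_seq [RHS]big_seq.
  apply: eq_bigr => f; rewrite mem_undup => /mapP[x r_x ->].
  rewrite /block_prod -!(big_filter r); apply: (@prod_max_norm _ `|x|) => y.
  rewrite mem_filter => /andP[/eqP eq_y r_y].
  apply: (pexpIrn n_gt0); rewrite ?nnegrE ?normr_ge0 // -!normrX.
  by rewrite (block_pow r_y eq_y).
(* Leaving out [t] can only decrease the product, as every factor is at least 1. *)
rewrite (perm_big _ perm_t) big_cat /= ler_peMr ?ler1_prod_max //.
by rewrite (le_trans ler01) ?ler1_prod_max.
Qed.

End Descent.

(** * Powers of a class, and the minimum over them *)

Lemma size_minpolyZ_num_field (Qs : fieldExtType rat)
    (iota : {rmorphism Qs -> algC}) (y : Qs) :
  (size (minpolyZ (iota y)) <= (\dim {:Qs}).+1)%N.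
Proof.
have [q Dq] := polyOver1_rat (minPolyOver 1%VS y).
have nz_q : q != 0.
  by apply: contraNneq (monic_neq0 (monic_minPoly 1%VS y)) => q0; rewrite Dq q0 rmorph0.
have [u [nz_u sz_u Du]] := rat_poly_clear_denominators nz_q.
have [_ _ min_y] := least_root_minpolyZ (iota y).
apply: (@leq_trans (size u)).
  by apply: min_y => //=; rewrite Du -(map_num_field_ratr iota) -Dq fmorph_root root_minPoly.
rewrite sz_u -(size_map_poly (in_alg Qs)) -Dq size_minPoly ltnS.
by rewrite adjoin_degreeE dimv1 divn1 dimvS // subvf.
Qed.

(** Frees membership from the reduced fraction of s: any a / b will do, a negative b being handled
    by inversion. *)
Lemma fiber_powI (g d : algC) (s : rat) (a b : int) :
  d != 0 -> b != 0 -> s * b%:~R = a%:~R -> d ^ b = g ^ a -> fiber_pow g s d.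
Proof.
move=> nz_d nz_b Ds Ddg; split=> //.
have Dab : numq s * b = denq s * a.
  by apply: (@intr_inj rat); rewrite !intrM -Ds numqE; ring.
exists `|b|%N; split; first by rewrite absz_gt0.
have Dd : d ^ (denq s * b) = g ^ (numq s * b).
  by rewrite Dab ![denq s * _]mulrC -!exprz_exp Ddg.
case: (intP b) Dd nz_b => [|n|n] // Dd _.
by apply: invr_inj; rewrite !invr_expz -!mulrN.
Qed.

Lemma fiber_pow_trans (g d e : algC) (s : rat) (n L : nat) :
  (0 < n)%N -> e != 0 -> e ^+ n = d ^+ (n * L) ->
  fiber_pow g s d -> fiber_pow g (s * L%:R) e.
Proof.
move=> n_gt0 nz_e Den [nz_d [m [m_gt0 Dd]]].
apply: (@fiber_powI _ _ _ (numq s * m * (n * L)%N) (n%:Z * (denq s * m))) => //.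
- by rewrite !mulf_neq0 ?denq_neq0 // eqz_nat -lt0n.
- by rewrite !intrM numqE pmulrn; ring.
rewrite -(exprz_exp e) -exprnP Den exprnP exprz_exp [_ * (denq s * _)]mulrC.
by rewrite -(exprz_exp d) Dd exprz_exp.
Qed.

(** The order on [algC] is total only on the reals, and P need not be decidable, hence the realness
    hypothesis and the classical case splits. *)
Lemma exists_min_real (vals : seq algC) (P : algC -> Prop) :
  (forall v, P v -> v \is Num.real) -> (exists2 v, v \in vals & P v) ->
  exists2 v, P v & forall w, w \in vals -> P w -> v <= w.
Proof.
move=> realP; elim: vals => [[] // | x vals IHvals [v vals_v Pv]].
have [[w vals_w Pw] | no_w] := classic (exists2 w, w \in vals & P w).
  have [u Pu min_u] := IHvals (ex_intro2 _ _ w vals_w Pw).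
  have [Px | nPx] := classic (P x); last first.
    by exists u => // z; rewrite inE => /predU1P[-> // | /min_u].
  have /orP[le_xu | le_ux] := real_leVge (realP x Px) (realP u Pu).
    exists x => // z; rewrite inE => /predU1P[-> // | vals_z Pz].
    by rewrite (le_trans le_xu) ?min_u.
  by exists u => // z; rewrite inE => /predU1P[-> // | /min_u].
exists v => // z; rewrite inE => z_in Pz.
suff [-> ->] : v = x /\ z = x by [].
by split; [move: vals_v; rewrite inE | move: z_in] => /predU1P[// | in_vals];
  case: no_w; [exists v | exists z].
Qed.

Lemma field_gen_expz (S : algC -> Prop) x (i : int) :
  field_gen S x -> field_gen S (x ^ i).
Proof.
move=> Kx; case: (intP i) => [|n|n]; rewrite -?exprnN -?exprnP.
- exact: field_gen_exp 0 Kx.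
- exact: field_gen_exp.
exact/fg_inv/field_gen_exp.
Qed.

Theorem mainTheorem8 (alpha gamma : algC) (halpha : alpha != 0) (hgamma : gamma != 0)
  (hS : inS (Kgal alpha) gamma)
  (hM : inf_le (Mset gamma 1) (mahler alpha)) :
  exists r : rat, r != 0 /\
    (forall s : rat, s != 0 -> inf_le_inf (Mset gamma r) (Mset gamma s)) /\
    inBbar alpha gamma r.
Proof.
have [Qs [iota KE]] := Kgal_num_field alpha.
have stable (nu : {rmorphism algC -> algC}) y : exists z, nu (iota y) = iota z.
  by apply/KE/Kgal_aut/KE; exists y.
(* Only some representative g of the class is known to be radical over K; the exponent n with g^n =
   gamma^n carries this over to gamma. *)
have [N N_gt0 KgN] : exists2 N, (0 < N)%N & Kgal alpha (gamma ^+ N).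
  case: hS => g [[nz_g [n [n_gt0 Dg]]] [_ [k [k_gt0 Kgk]]]].
  exists (k * n)%N; first by rewrite muln_gt0 k_gt0.
  move: Dg; rewrite /= !mul1r -!exprnP => Dg.
  by rewrite mulnC exprM -Dg -exprM mulnC exprM; apply: field_gen_exp.
(* The competitors: measures of elements of K lying in a non-zero power of the class of gamma. *)
pose T v := exists delta s,
  [/\ s != 0, fiber_pow gamma s delta, Kgal alpha delta & v = mahler delta].
have descent d s : s != 0 -> fiber_pow gamma s d -> exists2 v, T v & v <= mahler d.
  move=> nz_s fib_d; have [nz_d [m [m_gt0 Dd]]] := fib_d.
  (* The factor denq s * m turns d into a power of gamma, and N brings that power into K. *)
  pose n := (`|denq s| * m * N)%N.
  have n_gt0 : (0 < n)%N by rewrite !muln_gt0 absz_gt0 denq_neq0 m_gt0.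
  have Kdn : Kgal alpha (d ^+ n).
    have -> : d ^+ n = (gamma ^+ N) ^ (numq s * m).
      rewrite exprnP /n !PoszM absz_denq -(exprz_exp d) Dd (exprnP gamma).
      by rewrite !exprz_exp mulrC.
    exact: field_gen_expz.
  have [y Dy] := (KE _).1 Kdn.
  have [delta [L [L_gt0 [z Dz] Ddn le_M]]] := descent_to_num_field stable n_gt0 Dy.
  have nz_delta : delta != 0.
    by have := expf_neq0 (n * L) nz_d; rewrite -Ddn expf_eq0 n_gt0.
  exists (mahler delta) => //; exists delta, (s * L%:R); split=> //.
  - by rewrite mulf_neq0 // pnatr_eq0 -lt0n.
  - exact: fiber_pow_trans n_gt0 nz_delta Ddn fib_d.
  by apply/KE; exists z.
have Treal v : T v -> v \is Num.real.
  by case=> delta [s [_ _ _ ->]]; rewrite ger0_real ?mahler_ge0.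
have fib1 : fiber_pow gamma 1 gamma by split=> //; exists 1%N.
(* Any member of [T] serves as the bound in Northcott's theorem; values above C cannot affect the
   minimum. *)
have [C TC _] := descent gamma 1 (oner_neq0 _) fib1.
have [vals valsP] := mahler_northcott (\dim {:Qs}).+1 C.
have T_vals v : T v -> v <= C -> v \in vals.
  case=> delta [s [_ _ /KE[y ->] ->]]; apply: valsP.
  exact: size_minpolyZ_num_field.
have [v0 Tv0 min_v0] := exists_min_real Treal (ex_intro2 _ _ C (T_vals C TC (lexx C)) TC).
have {}min_v0 v : T v -> v0 <= v.
  move=> Tv; have /orP[le_vC | le_Cv] := real_leVge (Treal v Tv) (Treal C TC).
    exact: min_v0 (T_vals v Tv le_vC) Tv.
  by apply: le_trans le_Cv; apply: min_v0 => //; apply: T_vals.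
have min_fib d s : s != 0 -> fiber_pow gamma s d -> v0 <= mahler d.
  by move=> nz_s /(descent d s nz_s)[v /min_v0]; apply: le_trans.
case: Tv0 => delta [r [nz_r fib_delta Kdelta Dv0]]; exists r; split=> //; split.
  move=> s nz_s _ [d [fib_d ->]] e e_gt0; exists v0; split; first by exists delta.
  by rewrite (le_lt_trans (min_fib d s nz_s fib_d)) // ltrDl.
exists delta; split=> //; split=> //; split; first by case: fib_delta.
(* If v0 exceeded M(alpha), [hM] with e = v0 - M(alpha) would give a representative of the class of
   gamma with measure below v0, against [min_fib] at s = 1. *)
rewrite -Dv0 real_leNgt ?ger0_real ?mahler_ge0 // ?Dv0 ?mahler_ge0 //.
apply/negP; rewrite -Dv0 -subr_gt0 => /hM[_ [[d [fib_d ->]]]].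
rewrite addrC subrK => lt_d.
by have := le_lt_trans (min_fib d 1 (oner_neq0 _) fib_d) lt_d; rewrite ltxx.
Qed.
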